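(* For $|q|<1$, \begin{align*} \sum_{i,j,k\geq 0} \frac{q^{4i^2+2j^2+2k^2+4ij+4ik+2jk-j}}{(q^2;q^2)_i(q^2;q^2)_j(q^2;q^2)_k} &=\frac{1}{(q,q^4;q^5)_\infty},\\ \sum_{i,j,k\geq 0} \frac{q^{2i^2+j^2+k^2+2ij+2ik+jk}}{(q;q)_i (q;q)_j (q;q)_k}&=\frac{1}{(q,q^4;q^5)_\infty^2}, \\ \sum_{i,j,k\geq 0} \frac{q^{4i^2+2j^2+2k^2+4ij+4ik+2jk+2i+j}}{(q^2;q^2)_i(q^2;q^2)_j(q^2;q^2)_k}&=\frac{1}{(q^2,q^3;q^5)_\infty}, \\ \sum_{i,j,k\geq 0} \frac{q^{2i^2+j^2+k^2+2ij+2ik+jk+i+j}}{(q;q)_i (q;q)_j (q;q)_k}&=\frac{(q^5;q^5)_\infty}{(q;q)_\infty}, \\ \sum_{i,j,k\geq 0} \frac{q^{2i^2+j^2+k^2+2ij+2ik+jk+2i+j+k}}{(q;q)_i (q;q)_j (q;q)_k}&=\frac{1}{(q^2,q^3;q^5)_\infty^2}. \end{align*}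
   Context: For $|q|<1$: $(a;q)_n=\prod_{k=0}^{n-1}(1-aq^k)$ ($(a;q)_0=1$), $(a;q)_\infty=\prod_{k\ge0}(1-aq^k)$, $(a_1,\dots,a_m;q)_\infty=\prod_\ell(a_\ell;q)_\infty$. *)

(* Defs.v *)
From HB Require Import structures.
From mathcomp Require Import all_boot all_order all_algebra.
From mathcomp Require Import all_classical all_reals all_analysis.
From mathcomp Require Import complex.
Set Implicit Arguments. Unset Strict Implicit. Unset Printing Implicit Defensive.
Import Order.TTheory GRing.Theory Num.Theory.
Import numFieldNormedType.Exports.
Local Open Scope classical_set_scope.
Local Open Scope ring_scope.

Definition qpoch {K : numFieldType} (a q : K) (n : nat) : K :=
  \prod_(k < n) (1 - a * q ^+ k).

Definition qpoch_inf {K : numFieldType} (a q : K) : K :=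
  lim (qpoch a q @ \oo).

Definition cube_sum {K : numFieldType} (F : nat -> nat -> nat -> K) (N : nat) : K :=
  \sum_(i < N) \sum_(j < N) \sum_(k < N) F i j k.

(* Main.v *)
(* Idea.  With m = i + j and n = i + k the exponents of the second, fourth and
   fifth sums are m^2 + n^2 + jk plus linear terms, and q-Vandermonde gives
   sum_i q^((m-i)(n-i)) / ((q)_i (q)_(m-i) (q)_(n-i)) = 1 / ((q)_m (q)_n); those
   sums are products of two Rogers-Ramanujan series.  In the first and third
   sums put N = 2i + j + k: since (-z;q^2)(-zq;q^2)/(z^2;q^2) = 1/(z;q), the part
   of the sum with fixed N collapses to q^(N^2) / (q)_N, resp. q^(N^2+N) / (q)_N
   after exchanging j and k.

   The Rogers-Ramanujan identities follow from Bailey's lemma, itself an instance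
   of q-Vandermonde, applied twice to the unit Bailey pair.  The theta series so
   obtained is evaluated by the finite Jacobi triple product in base q^5, both
   passages to the limit being dominated by a geometric series. *)
Require Import Defs.
From HB Require Import structures.
From mathcomp Require Import all_boot all_order all_algebra.
From mathcomp Require Import all_classical all_reals all_analysis.
From mathcomp Require Import complex.
From mathcomp Require Import ring zify.
Set Implicit Arguments. Unset Strict Implicit. Unset Printing Implicit Defensive.
Import Order.TTheory GRing.Theory Num.Theory.
Import numFieldNormedType.Exports.
Local Open Scope classical_set_scope.
Local Open Scope ring_scope.

(** * Finite q-series identities, from Gaussian binomials to Bailey's lemma *)

Section FiniteIdentities.
Variables (K : numFieldType) (q : K).
Implicit Types (a b x : K) (n m l t d : nat).

Lemma qpochS a n : qpoch a q n.+1 = qpoch a q n * (1 - a * q ^+ n).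
Proof. by rewrite /qpoch big_ord_recr. Qed.

Lemma qpoch0 a : qpoch a q 0 = 1.
Proof. by rewrite /qpoch big_ord0. Qed.

Lemma qpochSl a n : qpoch a q n.+1 = (1 - a) * qpoch (a * q) q n.
Proof.
rewrite /qpoch big_ord_recl expr0 mulr1; congr (_ * _).
by apply: eq_bigr => i _; rewrite exprS mulrA.
Qed.

Lemma qpoch1 n : qpoch 1 q n = (n == 0)%:R.
Proof. by case: n => [|n]; rewrite ?qpoch0// qpochSl subrr mul0r. Qed.

Lemma qpoch_invS n : qpoch q q n.+1 != 0 ->
  (qpoch q q n.+1)^-1 * (1 - q ^+ n.+1) = (qpoch q q n)^-1.
Proof.
rewrite qpochS -exprS mulf_eq0 negb_or => /andP[? ?].
by rewrite invfM mulfVK.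
Qed.

(** The Gaussian binomial, defined by q-Pascal recursion so that no division occurs; [qbinE]
    recovers the quotient of factorials. *)
Fixpoint qbin n l : K :=
  match n, l with
  | _, 0 => 1
  | 0, _.+1 => 0
  | n'.+1, l'.+1 => qbin n' l' + q ^+ l * qbin n' l
  end.

Lemma qbinn0 n : qbin n 0 = 1. Proof. by case: n. Qed.

Lemma qbin_small n l : (n < l)%N -> qbin n l = 0.
Proof.
elim: n l => [|n IHn] [|l]//; rewrite ltnS /= => ltnl.
have -> : qbin n l = 0 by exact: IHn.
have -> : qbin n l.+1 = 0 by rewrite IHn// ltnW.
by rewrite mulr0 addr0.
Qed.

Lemma qbin_fact n l :
  qbin (l + n) l * (qpoch q q l * qpoch q q n) = qpoch q q (l + n).
Proof.
(* The two terms of Pascal's rule lower different arguments, but both lower l + n by one: hence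
   induction on a bound N for l + n. *)
move: {2}(l + n)%N (leqnn (l + n)) => N; elim: N l n => [|N IHN] [|l] [|n];
  rewrite ?addn0 ?add0n ?qpoch0 ?qbinn0 ?mulr1 ?mul1r// => leN.
  have -> : qbin l.+1 l.+1 = qbin l l by rewrite /= (@qbin_small l l.+1)// mulr0 addr0.
  have := IHN l 0%N; rewrite addn0 qpoch0 mulr1 => IH.
  by rewrite [qpoch q q l.+1]qpochS mulrA IH.
have -> : qbin (l.+1 + n.+1) l.+1
    = qbin (l + n.+1) l + q ^+ l.+1 * qbin (l.+1 + n) l.+1.
  by rewrite addSn (addSnnS l n).
rewrite mulrDl.
have -> : qbin (l + n.+1) l * (qpoch q q l.+1 * qpoch q q n.+1)
    = qpoch q q (l + n.+1) * (1 - q ^+ l.+1).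
  by rewrite -IHN; [rewrite [qpoch q q l.+1]qpochS exprS; ring | lia].
have -> : q ^+ l.+1 * qbin (l.+1 + n) l.+1 * (qpoch q q l.+1 * qpoch q q n.+1)
    = qpoch q q (l + n.+1) * (q ^+ l.+1 * (1 - q ^+ n.+1)).
  by rewrite -addSnnS -IHN; [rewrite [qpoch q q n.+1]qpochS (exprS q n); ring | lia].
rewrite addSn [RHS]qpochS -exprS -addSn exprD; ring.
Qed.

(** Pascal's rule moved onto the weights: an induction on m then reduces to a relation between
    [c t.+1] and [c t]. *)
Lemma sum_qbin_pascal (c : nat -> K) m :
  \sum_(t < m.+2) qbin m.+1 t * c t =
  \sum_(t < m.+1) qbin m t * (c t.+1 + q ^+ t * c t).
Proof.
under [RHS]eq_bigr do rewrite mulrDr.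
rewrite big_ord_recl /= mul1r.
under eq_bigr do rewrite /bump /= add1n mulrDl.
rewrite !big_split /= addrCA; congr (_ + _).
rewrite big_ord_recr /= [X in _ + (_ + X)](_ : _ = 0); last first.
  by rewrite qbin_small// mulr0 mul0r.
rewrite addr0 [RHS]big_ord_recl /= qbinn0 expr0 !mul1r; congr (_ + _).
by apply: eq_bigr => i _; rewrite /bump /= add1n mulrCA mulrA.
Qed.

(** Pascal's rule turns the weight into 1 - x times the weight for xq, which matches peeling the
    first factor off (x;q)_n. *)
Lemma qbinomial x n :
  \sum_(t < n.+1) qbin n t * ((- x) ^+ t * q ^+ 'C(t, 2)) = qpoch x q n.
Proof.
elim: n x => [|n IHn] x.
  by rewrite big_ord1 qpoch0 /= mul1r expr0 mul1r bin_small.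
rewrite (sum_qbin_pascal (fun t => (- x) ^+ t * q ^+ 'C(t, 2))).
rewrite qpochSl -IHn mulr_sumr; apply: eq_bigr => t _.
rewrite binS bin1 exprD exprS -mulNr exprMn; ring.
Qed.

Hypothesis qq_neq0 : forall n, qpoch q q n != 0.
Let iq n := (qpoch q q n)^-1.

Let iqS n : iq n = iq n.+1 * (1 - q ^+ n.+1).
Proof. by rewrite /iq qpoch_invS. Qed.

Lemma qbinE l n : qbin (l + n) l = qpoch q q (l + n) * (iq l * iq n).
Proof. by rewrite -qbin_fact /iq -invfM mulfK// mulf_neq0. Qed.

Lemma qbin_sub n l : (l <= n)%N -> qbin n (n - l) = qbin n l.
Proof.
move=> /subnKC <-; move: (n - l)%N => {}n.
by rewrite addKn {1}addnC !qbinE (addnC n) (mulrC (iq n)).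
Qed.

Lemma sum_qbin_rev (c : nat -> K) n :
  \sum_(t < n.+1) qbin n t * c t = \sum_(t < n.+1) qbin n t * c (n - t)%N.
Proof.
rewrite (reindex_inj rev_ord_inj) /=; apply: eq_bigr => t _.
by rewrite subSS qbin_sub// -ltnS.
Qed.

Lemma sum_qbin_pascal_dual (c : nat -> K) m :
  \sum_(t < m.+2) qbin m.+1 t * c t =
  \sum_(t < m.+1) qbin m t * (c t + q ^+ (m - t) * c t.+1).
Proof.
rewrite sum_qbin_rev (sum_qbin_pascal (fun t => c (m.+1 - t)%N)).
rewrite [RHS](sum_qbin_rev (fun t => c t + q ^+ (m - t) * c t.+1)).
apply: eq_bigr => t _; have := ltn_ord t; rewrite ltnS => ltm.
by rewrite subSS subKn// subSn.
Qed.

Lemma qvandermonde m d :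
  \sum_(t < m.+1) q ^+ (t * (t + d)) * (iq (m - t) * iq t * iq (t + d))
    = iq m * iq (m + d).
Proof.
(* Once (q)_m / ((q)_(m-t) (q)_t) is written as [qbin m t], Pascal's rule turns the weight for d
   into the weight for d + 1, so the induction on m must leave d free. *)
have : \sum_(t < m.+1) qbin m t * (q ^+ (t * (t + d)) * iq (t + d)) = iq (m + d).
  elim: m d => [|m IHm] d.
    by rewrite big_ord1 /= mul0n expr0 !mul1r add0n.
  rewrite (sum_qbin_pascal (fun t => q ^+ (t * (t + d)) * iq (t + d))).
  rewrite addSnnS -IHm; apply: eq_bigr => t _; congr (_ * _).
  rewrite [iq (t + d)]iqS -!addnS !addSn -!addnS.
  have -> : (t.+1 * (t + d.+1) = t * (t + d.+1) + (t + d.+1))%N by lia.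
  have -> : (t * (t + d.+1) = t * (t + d) + t)%N by lia.
  rewrite !exprD; ring.
move=> <-; rewrite mulr_sumr; apply: eq_bigr => t _.
case: t => t /=; rewrite ltnS => /subnKC <-; move: (m - t)%N => n.
rewrite qbinE addKn.
have iqK : iq (t + n) * qpoch q q (t + n) = 1 by rewrite mulVf.
by rewrite -[LHS]mul1r -iqK; ring.
Qed.

(* The coefficient of z^(l - n) in the triple product with a = z, b = q / z;
   both branches avoid negative powers of z and q. *)
Definition jtp_coef a b n l : K :=
  if (n <= l)%N then (- a) ^+ (l - n) * q ^+ 'C(l - n, 2)
  else (- b) ^+ (n - l) * q ^+ 'C(n - l, 2).

(** Induction on m: the dual Pascal rule multiplies each coefficient by 1 - a q^m, the new factor.
    The start m = 0 is the q-binomial theorem for b, read backwards. *)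
Lemma finite_jtp a b m n : a * b = q ->
  \sum_(l < (m + n).+1) qbin (m + n) l * jtp_coef a b n l
    = qpoch a q m * qpoch b q n.
Proof.
move=> abq; elim: m => [|m IHm].
  rewrite add0n qpoch0 mul1r (sum_qbin_rev (jtp_coef a b n)) -qbinomial; apply: eq_bigr => l _.
  congr (_ * _); rewrite /jtp_coef; have := ltn_ord l; rewrite ltnS => leln.
  rewrite subKn//; case: leqP => // len.
  have -> : nat_of_ord l = 0%N by lia.
  by rewrite subn0 subnn.
rewrite addSn (sum_qbin_pascal_dual (jtp_coef a b n)) qpochS mulrAC -IHm mulr_suml.
apply: eq_bigr => l _; rewrite -mulrA; congr (_ * _).
rewrite mulrBr mulr1; congr (_ + _).
case: l => l /=; rewrite ltnS /jtp_coef => leln.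
have [lenl|ltln] := leqP n l.
  rewrite leqW// subSn// binS bin1 exprD exprS.
  have -> : q ^+ m = q ^+ (m + n - l) * q ^+ (l - n) by rewrite -exprD; congr (_ ^+ _); lia.
  ring.
(* Left of the centre l = n the next coefficient has one factor b fewer; ab = q supplies it again,
   together with the wanted a. *)
have [i ni] : exists i, n = (l + i.+1)%N by exists (n - l).-1; lia.
rewrite ni; have -> : (l + i.+1 - l = i.+1)%N by lia.
have -> : (m + (l + i.+1) - l = m + i.+1)%N by lia.
(* At i = 0 the index l + 1 reaches the centre and the test selects the branch in a; both branches
   equal 1 there. *)
have -> : (if (l + i.+1 <= l.+1)%N then
    (- a) ^+ (l.+1 - (l + i.+1)) * q ^+ 'C(l.+1 - (l + i.+1), 2)
  else (- b) ^+ (l + i.+1 - l.+1) * q ^+ 'C(l + i.+1 - l.+1, 2))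
  = (- b) ^+ i * q ^+ 'C(i, 2).
  have -> : (l + i.+1 - l.+1 = i)%N by lia.
  case: leqP => //; case: i {ni} => [|i] ?; last by lia.
  by rewrite addn1 subnn.
have -> : q ^+ (m + i.+1) = q ^+ m * (a * b) * q ^+ i.
  by rewrite abq exprD exprS mulrA.
rewrite binS bin1 (exprD q) (exprS (- b)); ring.
Qed.

Lemma finite_jtp_inv a b m n : a * b = q ->
  \sum_(l < (m + n).+1) jtp_coef a b n l * (iq l * iq (m + n - l))
    = qpoch a q m * qpoch b q n * iq (m + n).
Proof.
move=> /(@finite_jtp a b m n) <-; rewrite mulr_suml; apply: eq_bigr => -[l /=].
rewrite ltnS => /subnKC; move: (m + n - l)%N => k <- _; rewrite qbinE.
have iqK : qpoch q q (l + k) * iq (l + k) = 1 by rewrite mulfV.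
by rewrite -[LHS]mul1r -iqK; ring.
Qed.

(* Pairs the terms j and -j of the bilateral theta series when e is false,
   the terms -j and j + 1 when e is true. *)
Definition jtp_fold (e : bool) a b (j : nat) : K :=
  if e then (- b) ^+ j * q ^+ 'C(j, 2) + (- a) ^+ j.+1 * q ^+ 'C(j.+1, 2)
  else if j is 0 then 1 else ((- a) ^+ j + (- b) ^+ j) * q ^+ 'C(j, 2).

Lemma jtp_coef_r a b n j : jtp_coef a b n (n + j) = (- a) ^+ j * q ^+ 'C(j, 2).
Proof. by rewrite /jtp_coef leq_addr addKn. Qed.

Lemma jtp_coef_l a b n j : (j <= n)%N ->
  jtp_coef a b n (n - j) = (- b) ^+ j * q ^+ 'C(j, 2).
Proof.
move=> lejn; rewrite /jtp_coef subKn//; case: leqP => // lenj.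
have -> : j = 0%N by lia.
by rewrite subn0 subnn.
Qed.

(** Folding gives the triple product the shape of a Bailey pair relative to q^e, up to
    normalisation. *)
Lemma folded_jtp e a b n : a * b = q ->
  \sum_(j < n.+1) jtp_fold e a b j * (iq (n - j) * iq (n + j + e))
    = qpoch a q (n + e) * qpoch b q n * iq (n + e + n).
Proof.
move=> /finite_jtp_inv <-; case: e.
  have -> : ((n + true + n).+1 = n.+1 + n.+1)%N by lia.
  rewrite big_split_ord /= [X in X + _](reindex_inj rev_ord_inj) /= -big_split.
  apply: eq_bigr => -[j /=]; rewrite ltnS => lejn _.
  rewrite subSS jtp_coef_l// addSn -addnS jtp_coef_r.
  have -> : (n + true + n - (n - j) = n + j + 1)%N by lia.
  have -> : (n + true + n - (n + j.+1) = n - j)%N by lia.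
  have -> : (n + j.+1 = n + j + 1)%N by lia.
  rewrite /jtp_fold; ring.
rewrite !addn0 -addnS big_split_ord /= [in RHS]big_ord_recl [in LHS]big_ord_recl.
rewrite /= (jtp_coef_r _ _ _ 0) !addn0 subn0 addnK expr0 bin_small// expr0 mul1r.
rewrite mul1r addrCA; congr (_ + _).
rewrite [X in X + _](reindex_inj rev_ord_inj) /= -big_split.
apply: eq_bigr => -[j /=] ltjn _.
rewrite /bump /= add1n jtp_coef_l// jtp_coef_r.
have -> : (n + n - (n - j.+1) = n + j.+1)%N by lia.
have -> : (n + n - (n + j.+1) = n - j.+1)%N by lia.
rewrite addn0; ring.
Qed.

(** Bailey's lemma with both parameters sent to infinity. After exchanging the sums, the inner sum
    over s = t + j is q-Vandermonde with m = n - j and d = 2j + e. *)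
Lemma bailey_step (e : bool) (B : nat -> K) n :
  \sum_(s < n.+1) q ^+ (s ^ 2 + e * s) * iq (n - s) *
    (\sum_(j < s.+1) B j * (iq (s - j) * iq (s + j + e)))
  = \sum_(j < n.+1) B j * q ^+ (j ^ 2 + e * j) * (iq (n - j) * iq (n + j + e)).
Proof.
transitivity (\sum_(s < n.+1) \sum_(j < n.+1 | (j <= s)%N) q ^+ (s ^ 2 + e * s)
    * iq (n - s) * (B j * (iq (s - j) * iq (s + j + e)))).
  apply: eq_bigr => s _; rewrite mulr_sumr.
  by rewrite (big_ord_widen_cond _ xpredT (fun j => q ^+ (s ^ 2 + e * s)
    * iq (n - s) * (B j * (iq (s - j) * iq (s + j + e)))) (ltn_ord s)).
rewrite (exchange_big_dep xpredT)//=; apply: eq_bigr => -[j /=].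
rewrite ltnS => lejn _.
pose F s := q ^+ (s ^ 2 + e * s) * iq (n - s) *
  (B j * (iq (s - j) * iq (s + j + e))).
rewrite -(big_geq_mkord _ _ xpredT F) -{1}[j]add0n big_addn big_mkord subSn//.
have -> : (n + j + e = (n - j) + (2 * j + e))%N by lia.
rewrite -qvandermonde mulr_sumr; apply: eq_bigr => -[t /=].
rewrite ltnS /F => letn _.
have -> : (n - (t + j) = n - j - t)%N by lia.
have -> : (t + j + j + e = t + (2 * j + e))%N by lia.
have -> : ((t + j) ^ 2 + e * (t + j) = (j ^ 2 + e * j) + t * (t + (2 * j + e)))%N.
  by lia.
rewrite addnK exprD; ring.
Qed.

Lemma finite_rogers_ramanujan (e : bool) n :
  \sum_(s < n.+1) q ^+ (s ^ 2 + e * s) * (iq s * iq (n - s))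
  = \sum_(j < n.+1) jtp_fold e q 1 j * q ^+ (2 * (j ^ 2 + e * j))
      * (iq (n - j) * iq (n + j + e)).
Proof.
(* At b = 1 the product (1;q)_s vanishes for s > 0: this is the unit Bailey pair. *)
have unit_pair s : \sum_(j < s.+1) jtp_fold e q 1 j * (iq (s - j) * iq (s + j + e))
    = (s == 0)%:R.
  rewrite folded_jtp ?mulr1// qpoch1; case: s => [|s]; rewrite ?mulr0 ?mul0r//.
  by rewrite mulr1 !addn0 mulfV.
have step1 m : iq m = \sum_(j < m.+1) jtp_fold e q 1 j * q ^+ (j ^ 2 + e * j)
    * (iq (m - j) * iq (m + j + e)).
  rewrite -bailey_step; under eq_bigr do rewrite unit_pair.
  rewrite big_ord_recl big1 => [|i _]; last by rewrite mulr0.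
  by rewrite muln0 expr0 subn0 mul1r mulr1 addr0.
transitivity (\sum_(s < n.+1) q ^+ (s ^ 2 + e * s) * iq (n - s) * iq s).
  by apply: eq_bigr => s _; ring.
(* The first Bailey step has expressed 1/(q)_s; inserting it here sets up the second step. *)
under eq_bigr do rewrite [iq (nat_of_ord _)]step1.
rewrite (bailey_step e (fun j => jtp_fold e q 1 j * q ^+ (j ^ 2 + e * j))).
by apply: eq_bigr => j _; rewrite -[_ * q ^+ _ * q ^+ _]mulrA -exprD addnn -mul2n.
Qed.

End FiniteIdentities.
Lemma sqrn_bin2 n : (n ^ 2 = 2 * 'C(n, 2) + n)%N.
Proof. by elim: n => // n; rewrite binS bin1 => IHn; lia. Qed.

(** The two Bailey steps add four times the binomial exponent to the one already present, which
    gives base q^5; the leftover linear exponents turn q and 1 into the new a and b, with product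
    q^5. *)
Lemma theta_base_change (K : numFieldType) (q : K) (e : bool) j :
  jtp_fold q e q 1 j * q ^+ (2 * (j ^ 2 + e * j))
  = jtp_fold (q ^+ 5) e (if e then q else q ^+ 3) (if e then q ^+ 4 else q ^+ 2) j.
Proof.
have -> : (2 * (j ^ 2 + e * j) = 4 * 'C(j, 2) + 2 * j + 2 * e * j)%N.
  by rewrite sqrn_bin2; lia.
case: e => /=; rewrite ?muln0 ?mul0n ?addn0 ?muln1.
  rewrite mulrDl binS bin1 (exprNn (q ^+ 4)) -!exprM -!mulrA -!exprD.
  by congr (_ * q ^+ _ + _ * q ^+ _); lia.
case: j => [|j]; first by rewrite !expr0 mulr1.
rewrite (exprNn q) (exprNn (q ^+ 3)) (exprNn (q ^+ 2)) -!exprM !mulrDl -!mulrA.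
rewrite -!exprD; congr (_ * q ^+ _ + _ * q ^+ _); lia.
Qed.

(** * Cauchy products and sums over fibres *)

Section Convolution.
Variable K : comNzRingType.
Implicit Types (f g : nat -> K) (i j n M : nat).

(** A sequence stands for a power series in z: [cauchy_prod] multiplies two series, [coef_shift]
    multiplies by z, and the weight q^n replaces z by zq. *)
Definition cauchy_prod f g n : K := \sum_(j < n.+1) f j * g (n - j)%N.
Definition coef_shift f n : K := if n is n'.+1 then f n' else 0.

Lemma eq_cauchy_prod f f' g g' n : f =1 f' -> g =1 g' -> cauchy_prod f g n = cauchy_prod f' g' n.
Proof. by move=> ff' gg'; apply: eq_bigr => j _; rewrite ff' gg'. Qed.

Lemma cauchy_prodC f g n : cauchy_prod f g n = cauchy_prod g f n.
Proof.
rewrite /cauchy_prod (reindex_inj rev_ord_inj) /=; apply: eq_bigr => -[j /=].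
by rewrite ltnS => lejn _; rewrite subSS subKn// mulrC.
Qed.

Lemma cauchy_prodDl f f' g n :
  cauchy_prod (fun m => f m + f' m) g n = cauchy_prod f g n + cauchy_prod f' g n.
Proof. by rewrite -big_split; apply: eq_bigr => j _; rewrite mulrDl. Qed.

Lemma cauchy_prod_shiftl f g n : cauchy_prod (coef_shift f) g n = coef_shift (cauchy_prod f g) n.
Proof.
rewrite /cauchy_prod big_ord_recl mul0r add0r; case: n => [|n] /=; first by rewrite big_ord0.
by apply: eq_bigr => j _; rewrite /bump /= add1n subSS.
Qed.

Lemma cauchy_prod_dilate (q : K) f g n :
  cauchy_prod (fun m => q ^+ m * f m) (fun m => q ^+ m * g m) n = q ^+ n * cauchy_prod f g n.
Proof.
rewrite /cauchy_prod mulr_sumr; apply: eq_bigr => -[j /=]; rewrite ltnS => lejn _.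
by rewrite -{3}(subnKC lejn) exprD; ring.
Qed.

Lemma sum_delta f M n :
  \sum_(k < M) (k == n :> nat)%N%:R * f k = (n < M)%N%:R * f n.
Proof.
case: ltnP => [ltnM|leMn].
  rewrite (bigD1 (Ordinal ltnM))//= eqxx big1 ?addr0// => i /eqP neqi.
  have [eqin|_] := eqVneq (i : nat) n; last by rewrite mul0r.
  by case: neqi; apply: val_inj.
rewrite big1 ?mul0r// => i _; have [eqin|_] := eqVneq (i : nat) n; last by rewrite mul0r.
by move: (ltn_ord i); rewrite eqin ltnNge leMn.
Qed.

Lemma sum_delta_add f M n i : (n < M)%N ->
  \sum_(k < M) (i + k == n)%N%:R * f k = (i <= n)%N%:R * f (n - i)%N.
Proof.
move=> ltnM; have [lein|ltni] := leqP i n.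
  under eq_bigr => k _ do have -> : (i + k == n)%N = (k == n - i :> nat)%N by lia.
  by rewrite sum_delta (leq_ltn_trans _ ltnM)// leq_subr.
rewrite mul0r big1// => k _; case: eqP => [|_]; last by rewrite mul0r.
by lia.
Qed.

Lemma sum_widen_le f M n : (n < M)%N ->
  \sum_(i < n.+1) f i = \sum_(i < M) (i <= n)%N%:R * f i.
Proof.
move=> ltnM; rewrite (big_ord_widen _ f ltnM) big_mkcond /=; apply: eq_bigr => i _.
by rewrite ltnS; case: ifP; rewrite ?mul1r ?mul0r.
Qed.

(** Groups the indices i by the value of X. Only values below M are met on the left, hence the
    indicator on the right. *)
Lemma sum_fiber (I : finType) (c : nat -> K) (X : I -> nat) (F : I -> K) M :
  \sum_(n < M) c n * (\sum_i (X i == n)%N%:R * F i)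
  = \sum_i (X i < M)%N%:R * (c (X i) * F i).
Proof.
under eq_bigr do rewrite mulr_sumr.
rewrite exchange_big /=; apply: eq_bigr => i _.
under eq_bigr do rewrite mulrCA (eq_sym (X i)).
by rewrite (sum_delta (fun n => c n * F i)).
Qed.

Lemma sum_cube (F : nat -> nat -> nat -> K) M :
  \sum_(i < M) \sum_(j < M) \sum_(k < M) F i j k
  = \sum_(x : 'I_M * 'I_M * 'I_M) F x.1.1 x.1.2 x.2.
Proof. by rewrite pair_big /= pair_big /=; apply: eq_bigr => -[[i j] k]. Qed.

End Convolution.

(** * Reciprocals of q-factorials as sums over triples *)

Section Fibers.
Variables (K : numFieldType) (q : K).
Hypothesis qq_neq0 : forall n, qpoch q q n != 0.
Let iq n := (qpoch q q n)^-1.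

Let iqS n : iq n.+1 * (1 - q ^+ n.+1) = iq n.
Proof. exact: qpoch_invS. Qed.

(** The two conditions force j = m - i and k = n - i, so this is q-Vandermonde with t = m - i.
    Indicators on the whole cube allow the later exchange with sums over m and n. *)
Lemma qvandermonde_fiber m n M : (m < M)%N -> (n < M)%N ->
  iq m * iq n = \sum_(i < M) \sum_(j < M) \sum_(k < M)
    (i + j == m)%N%:R * ((i + k == n)%N%:R * (q ^+ (j * k) * (iq i * iq j * iq k))).
Proof.
(* [qvandermonde] covers n = m + d; exchanging j and k gives the other case. *)
wlog lemn : m n / (m <= n)%N => [wl|] ltmM ltnM.
  have [lemn|ltnm] := leqP m n; first exact: wl.
  rewrite mulrC (wl n m)//; last exact: ltnW.
  apply: eq_bigr => i _; rewrite exchange_big /=; apply: eq_bigr => j _.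
  by apply: eq_bigr => k _; rewrite mulrCA (mulnC k) (mulrAC (iq i)).
transitivity (\sum_(i < M) (i <= m)%N%:R *
    (q ^+ ((m - i) * (n - i)) * (iq i * iq (m - i) * iq (n - i)))); last first.
  apply: eq_bigr => i _; symmetry.
  under eq_bigr => j _ do rewrite -mulr_sumr
    (sum_delta_add (fun k => q ^+ (j * k) * (iq i * iq j * iq k)))//.
  rewrite (sum_delta_add (fun j => (i <= n)%N%:R * (q ^+ (j * (n - i)) *
    (iq i * iq j * iq (n - i)))))//.
  by case: leqP => [leim|]; rewrite ?mul0r// (leq_trans leim) ?mul1r.
rewrite -(sum_widen_le (fun i => q ^+ ((m - i) * (n - i)) *
  (iq i * iq (m - i) * iq (n - i))))//.
have -> : n = (m + (n - m))%N by rewrite subnKC.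
rewrite -qvandermonde// (reindex_inj rev_ord_inj) /=; apply: eq_bigr => -[i /=].
rewrite ltnS subSS => leim _; rewrite subKn//.
have -> : (m + (n - m) - i = m - i + (n - m))%N by lia.
by congr (_ * _); ring.
Qed.

Hypothesis q2_neq0 : forall n, qpoch (q ^+ 2) (q ^+ 2) n != 0.
Let i2 n := (qpoch (q ^+ 2) (q ^+ 2) n)^-1.

Let i2S n : i2 n.+1 * (1 - q ^+ n.+1.*2) = i2 n.
Proof. by rewrite /i2 -(qpoch_invS (q2_neq0 n.+1)) -exprM mul2n. Qed.

(** The recursion says f(z) - f(zq) = z f(z), which together with f(0) = 1 determines 1/(z;q)_oo. *)
Lemma iq_uniq (v : nat -> K) : v 0 = 1 ->
  (forall n, v n.+1 * (1 - q ^+ n.+1) = v n) -> v =1 iq.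
Proof.
move=> v0 vS; elim=> [|n IHn]; first by rewrite v0 /iq qpoch0 invr1.
have := qq_neq0 n.+1; rewrite qpochS -exprS mulf_eq0 negb_or => /andP[_ nz].
by apply: (mulIf nz); rewrite vS iqS.
Qed.

(** Euler's coefficients of E(z) = (-z;q^2)_oo; [ecE] is E(z) = (1 + z) E(zq^2). *)
Let ec n := q ^+ (2 * 'C(n, 2)) * i2 n.

Let ecE n : ec n = q ^+ n * (q ^+ n * ec n) + coef_shift (fun m => q ^+ m * (q ^+ m * ec m)) n.
Proof.
case: n => [|n] /=; first by rewrite addr0 !mul1r.
rewrite /ec; have -> : q ^+ (2 * 'C(n.+1, 2)) = q ^+ (2 * 'C(n, 2)) * q ^+ n * q ^+ n.
  by rewrite -!exprD binS bin1; congr (_ ^+ _); lia.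
by rewrite -[i2 n]i2S -addnn exprD; ring.
Qed.

(* Euler: the coefficients of (-z;q^2)_oo (-zq;q^2)_oo = (-z;q)_oo. *)
Let conv_ec n : cauchy_prod ec (fun m => q ^+ m * ec m) n = q ^+ 'C(n, 2) * iq n.
Proof.
set u := cauchy_prod _ _.
(* U(z) = E(z) E(zq) satisfies U(z) = (1 + z) U(zq), because E(zq^2) E(zq) = U(zq). *)
have uE m : u m = q ^+ m * u m + coef_shift (fun k => q ^+ k * u k) m.
  rewrite {1}/u (eq_cauchy_prod _ ecE (fun=> erefl)) cauchy_prodDl cauchy_prod_shiftl.
  have dil k : cauchy_prod (fun m => q ^+ m * (q ^+ m * ec m)) (fun m => q ^+ m * ec m) k
      = q ^+ k * u k by rewrite cauchy_prod_dilate cauchy_prodC.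
  by rewrite dil; congr (_ + _); case: m => //= m; rewrite dil.
elim: n => [|n IHn].
  by rewrite /u /cauchy_prod big_ord1 /ec /iq /i2 !qpoch0 /= !bin_small// !expr0 invr1 !mulr1.
have := qq_neq0 n.+1; rewrite qpochS -exprS mulf_eq0 negb_or => /andP[_ nz].
apply: (mulIf nz); rewrite -mulrA iqS mulrBr mulr1 {1}uE /= IHn binS bin1 exprD.
ring.
Qed.

(** Coefficients of D(z) = 1/(z^2;q^2)_oo; [dcE] is D(z) = z^2 D(z) + D(zq). *)
Let dc n := if odd n then 0 else i2 n./2.

Let dcE n : dc n = coef_shift (coef_shift dc) n + q ^+ n * dc n.
Proof.
case: n => [|[|n]] /=; rewrite ?add0r ?mul1r ?mulr0 ?addr0// /dc /= negbK.
case: ifPn => [|evn]; first by rewrite mulr0 addr0.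
by rewrite -[i2 n./2]i2S doubleS even_halfK//; ring.
Qed.

(* Since (z^2;q^2)_oo = (z;q)_oo (-z;q)_oo, these are the coefficients of
   (-z;q)_oo / (z^2;q^2)_oo = 1 / (z;q)_oo. *)
Let conv_dc n : cauchy_prod dc (fun m => q ^+ 'C(m, 2) * iq m) n = iq n.
Proof.
set g := fun m => _; set v := cauchy_prod _ _.
have gE m : g m = q ^+ m * g m + coef_shift (fun k => q ^+ k * g k) m.
  case: m => [|m] /=; first by rewrite mul1r addr0.
  by rewrite /g -[iq m]iqS binS bin1 exprD; ring.
have vE m : v m = coef_shift (coef_shift v) m + q ^+ m * v m + coef_shift (fun k => q ^+ k * v k) m.
  rewrite {1}/v (eq_cauchy_prod _ dcE (fun=> erefl)) cauchy_prodDl.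
  rewrite cauchy_prod_shiftl -addrA; congr (_ + _).
    by case: m => //= m; rewrite cauchy_prod_shiftl.
  rewrite cauchy_prodC (eq_cauchy_prod _ gE (fun=> erefl)) cauchy_prodDl cauchy_prod_shiftl.
  have dil k : cauchy_prod (fun m => q ^+ m * g m) (fun m => q ^+ m * dc m) k
      = q ^+ k * v k by rewrite cauchy_prod_dilate cauchy_prodC.
  by rewrite dil; congr (_ + _); case: m => //= m; rewrite dil.
have v0 : v 0 = 1.
  by rewrite /v /cauchy_prod big_ord1 /dc /g /iq /i2 /= !qpoch0 bin_small// !expr0 invr1 !mulr1.
(* [vE] says (1 - z^2) V(z) = (1 + z) V(zq). The factor 1 + z is cancelled by induction: consecutive
   coefficients of (1 - z) V(z) - V(zq) are opposite, and they start from 0. *)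
apply: iq_uniq => // {}n; apply/eqP; rewrite -subr_eq0; apply/eqP.
elim: n => [|n IHn]; first by rewrite mulrBr mulr1 {1}vE /= v0; ring.
by rewrite mulrBr mulr1 {1}vE /= -[RHS]oppr0 -[in RHS]IHn; ring.
Qed.

(** Coefficient of z^n in 1/(z;q)_oo = (-z;q^2)_oo (-zq;q^2)_oo / (z^2;q^2)_oo: i indexes the
    denominator, j and k the two products, with 2 C(j,2) = j^2 - j and 2 C(k,2) + k = k^2. *)
Lemma euler_fiber n M : (n < M)%N ->
  iq n = \sum_(i < M) \sum_(j < M) \sum_(k < M) (2 * i + j + k == n)%N%:R *
    (q ^+ (j ^ 2 - j + k ^ 2) * (i2 i * i2 j * i2 k)).
Proof.
move=> ltnM; have dcM s : (s < M)%N -> dc s = \sum_(i < M) (2 * i == s)%N%:R * i2 i.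
  move=> ltsM; rewrite /dc; case: ifPn => [os|es].
    by rewrite big1// => i _; case: eqP => [|_]; [lia|rewrite mul0r].
  under eq_bigr => i _ do have -> : (2 * i == s)%N = (i == s./2 :> nat) by lia.
  by rewrite sum_delta (_ : _ < M)%N ?mul1r//; lia.
rewrite -conv_dc /cauchy_prod.
rewrite (sum_widen_le (fun j => dc j * (q ^+ 'C(n - j, 2) * iq (n - j)%N)) ltnM).
transitivity (\sum_(s < M) (s <= n)%N%:R * (q ^+ 'C(n - s, 2) * iq (n - s)%N) *
    \sum_(i < M) (2 * i == s)%N%:R * i2 i).
  by apply: eq_bigr => s _; rewrite -dcM//; ring.
rewrite (sum_fiber (fun s => (s <= n)%N%:R * (q ^+ 'C(n - s, 2) * iq (n - s)%N))).
apply: eq_bigr => i _; symmetry.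
under eq_bigr => j _ do rewrite
  (sum_delta_add (fun k => q ^+ (j ^ 2 - j + k ^ 2) * (i2 i * i2 j * i2 k)))//.
have [le2n|lt2n] := leqP (2 * i) n; last first.
  rewrite !mul0r mulr0 big1// => j _.
  by case: leqP => //; rewrite ?mul0r//; lia.
rewrite (leq_ltn_trans le2n ltnM) !mul1r -conv_ec /cauchy_prod mulr_suml.
have lt2M : (n - 2 * i < M)%N by lia.
rewrite (sum_widen_le (fun j => ec j * (q ^+ (n - 2 * i - j) * ec (n - 2 * i - j)%N)
  * i2 i) lt2M).
apply: eq_bigr => j _; have -> : (2 * i + j <= n)%N = (j <= n - 2 * i)%N by lia.
congr (_ * _); rewrite subnDA /ec; set k := (n - _ - _)%N.
rewrite exprD sqrn_bin2 addnK (sqrn_bin2 k) exprD; ring.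
Qed.

End Fibers.

(** * Truncated series as sums over regions of the cube *)

Section Regions.
Variables (K : numFieldType) (q : K).
Hypothesis qq_neq0 : forall n, qpoch q q n != 0.
Let iq n := (qpoch q q n)^-1.

(** Summing the fibres over m, n < M is exact but reaches only part of the cube; the remainder is
    disposed of in the limit, by [cvg_cube_region]. *)
Lemma qvandermonde_region (c c' : nat -> K) M :
  (\sum_(m < M) c m / qpoch q q m) * (\sum_(n < M) c' n / qpoch q q n)
  = cube_sum (fun i j k => ((i + j < M) && (i + k < M))%N%:R *
      (c (i + j)%N * c' (i + k)%N * q ^+ (j * k)
       / (qpoch q q i * qpoch q q j * qpoch q q k))) M.
Proof.
pose F (x : 'I_M * 'I_M * 'I_M) := q ^+ (x.1.2 * x.2) *
  (iq x.1.1 * iq x.1.2 * iq x.2).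
transitivity (\sum_(m < M) c m * \sum_(n < M) c' n * \sum_(x : 'I_M * 'I_M * 'I_M)
    (x.1.1 + x.2 == n)%N%:R * ((x.1.1 + x.1.2 == m)%N%:R * F x)).
  rewrite mulr_suml; apply: eq_bigr => m _; rewrite -mulrA; congr (_ * _).
  rewrite mulr_sumr; apply: eq_bigr => n _; rewrite mulrCA; congr (_ * _).
  rewrite (qvandermonde_fiber qq_neq0 (ltn_ord m) (ltn_ord n)).
  rewrite (sum_cube (fun i j k => (i + j == m)%N%:R * ((i + k == n)%N%:R *
    (q ^+ (j * k) * (iq i * iq j * iq k))))).
  by apply: eq_bigr => x _; rewrite mulrCA.
transitivity (\sum_(m < M) c m * \sum_(x : 'I_M * 'I_M * 'I_M) (x.1.1 + x.1.2 == m)%N%:R *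
    ((x.1.1 + x.2 < M)%N%:R * (c' (x.1.1 + x.2)%N * F x))).
  apply: eq_bigr => m _; congr (_ * _).
  rewrite (sum_fiber c' (fun x : 'I_M * 'I_M * 'I_M => x.1.1 + x.2)%N).
  by apply: eq_bigr => x _; ring.
rewrite (sum_fiber c (fun x : 'I_M * 'I_M * 'I_M => x.1.1 + x.1.2)%N).
rewrite /cube_sum (sum_cube (fun i j k => ((i + j < M) && (i + k < M))%N%:R *
  (c (i + j)%N * c' (i + k)%N * q ^+ (j * k)
       / (qpoch q q i * qpoch q q j * qpoch q q k)))).
by apply: eq_bigr => x _; rewrite -mulnb natrM /F !invfM /iq; ring.
Qed.

Hypothesis q2_neq0 : forall n, qpoch (q ^+ 2) (q ^+ 2) n != 0.

Lemma euler_region (c : nat -> K) M :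
  \sum_(n < M) c n / qpoch q q n
  = cube_sum (fun i j k => (2 * i + j + k < M)%N%:R *
      (c (2 * i + j + k)%N * q ^+ (j ^ 2 - j + k ^ 2)
       / (qpoch (q ^+ 2) (q ^+ 2) i * qpoch (q ^+ 2) (q ^+ 2) j
          * qpoch (q ^+ 2) (q ^+ 2) k))) M.
Proof.
pose i2 n := (qpoch (q ^+ 2) (q ^+ 2) n)^-1.
pose F (x : 'I_M * 'I_M * 'I_M) := q ^+ (x.1.2 ^ 2 - x.1.2 + x.2 ^ 2) *
  (i2 x.1.1 * i2 x.1.2 * i2 x.2).
transitivity (\sum_(n < M) c n * \sum_(x : 'I_M * 'I_M * 'I_M)
    (2 * x.1.1 + x.1.2 + x.2 == n)%N%:R * F x).
  apply: eq_bigr => n _; rewrite (euler_fiber qq_neq0 q2_neq0 (ltn_ord n)).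
  by rewrite (sum_cube (fun i j k => (2 * i + j + k == n)%N%:R *
    (q ^+ (j ^ 2 - j + k ^ 2) * (i2 i * i2 j * i2 k)))).
rewrite (sum_fiber c (fun x : 'I_M * 'I_M * 'I_M => 2 * x.1.1 + x.1.2 + x.2)%N).
rewrite /cube_sum (sum_cube (fun i j k => (2 * i + j + k < M)%N%:R *
  (c (2 * i + j + k)%N * q ^+ (j ^ 2 - j + k ^ 2)
       / (qpoch (q ^+ 2) (q ^+ 2) i * qpoch (q ^+ 2) (q ^+ 2) j
          * qpoch (q ^+ 2) (q ^+ 2) k)))).
by apply: eq_bigr => x _; rewrite /F !invfM /i2; ring.
Qed.

End Regions.

(** * Dominated passage to the limit *)

Section Tannery.
Variables (K : numFieldType) (r : K).
Hypotheses (r_ge0 : 0 <= r) (r_lt1 : r < 1) (r_cvg : (fun n => r ^+ n) @ \oo --> (0 : K)).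

Lemma sum_geo_le n : \sum_(i < n) r ^+ i <= (1 - r)^-1.
Proof.
have r1 : 0 < 1 - r by rewrite subr_gt0.
rewrite -(ler_pM2l r1) mulfV ?gt_eqF// -opprB mulNr -subrX1 opprB gerBl.
exact: exprn_ge0.
Qed.

Lemma cvg_sum_ord_0 M (f : nat -> nat -> K) :
  (forall i, (fun n => f n i) @ \oo --> (0 : K)) ->
  (fun n => \sum_(i < M) f n i) @ \oo --> (0 : K).
Proof.
move=> f0; elim: M => [|M IHM].
  by under eq_fun do rewrite big_ord0; exact: cvg_cst.
under eq_fun do rewrite big_ord_recr.
by have := cvgD IHM (f0 M); rewrite addr0; apply.
Qed.

(** Tannery's theorem: below a fixed M finitely many null sequences are added, and from M on the sum
    is at most C r^M / (1 - r). *)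
Lemma tannery (f : nat -> nat -> K) (N : nat -> nat) (C : K) : 0 <= C ->
  (forall n i, `|f n i| <= C * r ^+ i) ->
  (forall i, (fun n => f n i) @ \oo --> (0 : K)) ->
  (fun n => \sum_(i < N n) f n i) @ \oo --> (0 : K).
Proof.
move=> C0 fC f0; apply/cvgr0Pnorm_lt => eps eps0.
have e2 : 0 < eps / 2 by rewrite divr_gt0.
have /cvgr0Pnorm_lt/(_ _ e2) [M _ tailM] :
    (fun n => C / (1 - r) * r ^+ n) @ \oo --> (0 : K).
  by have := @cvgMr _ _ _ _ _ (C / (1 - r)) _ r_cvg; rewrite mulr0; apply.
have {}tailM := tailM M (leqnn M).
have /cvgr0Pnorm_lt/(_ _ e2) head :
    (fun n => \sum_(i < M) `|f n i|) @ \oo --> (0 : K).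
  apply: (@cvg_sum_ord_0 M (fun n i => `|f n i|)) => i.
  by have := cvg_norm (f0 i); rewrite normr0; apply.
apply: filterS head => n headn.
apply: le_lt_trans (ler_norm_sum _ _ _) _.
have r1 : 0 < 1 - r by rewrite subr_gt0.
(* Padding to M + N n terms allows the split at M without comparing M with N n. *)
apply: (@le_lt_trans _ _ (\sum_(i < M + N n) `|f n i|)).
  rewrite addnC big_split_ord /= lerDl; exact: sumr_ge0.
rewrite big_split_ord /= [eps]splitr; apply: ltrD.
  by apply: le_lt_trans headn; rewrite real_ler_norm// ger0_real// sumr_ge0.
apply: le_lt_trans tailM.
rewrite ger0_norm; last by rewrite !mulr_ge0// ?invr_ge0 ?exprn_ge0// ltW.
apply: (@le_trans _ _ (\sum_(i < N n) C * r ^+ M * r ^+ i)).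
  by apply: ler_sum => i _; rewrite -mulrA -exprD.
rewrite -mulr_sumr [X in _ <= X]mulrAC.
by rewrite ler_wpM2l ?sum_geo_le// mulr_ge0 ?exprn_ge0.
Qed.

(** Replacing the weights by their limit changes the sum by a null sequence. As lam is nonzero the
    weights can be stripped off as well as put on; both directions serve below. *)
Lemma tannery_weight (c : nat -> K) (w : nat -> nat -> K) (C D lam S : K) :
  0 <= C -> 0 <= D -> lam != 0 ->
  (forall i, `|c i| <= C * r ^+ i) -> (forall n i, `|w n i| <= D) ->
  (forall i, (fun n => w n i) @ \oo --> lam) ->
  (fun n => \sum_(i < n.+1) c i * w n i) @ \oo --> S * lam <->
  (fun n => \sum_(i < n.+1) c i) @ \oo --> S.
Proof.
move=> C0 D0 lam0 cC wD wlam.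
have diff0 : (fun n => \sum_(i < n.+1) c i * (w n i - lam)) @ \oo --> (0 : K).
  apply: (@tannery (fun n i => c i * (w n i - lam)) succn (C * (D + `|lam|))) => [|n i|i].
  - by rewrite mulr_ge0// addr_ge0.
  - rewrite normrM mulrAC ler_pM//; apply: le_trans (ler_normB _ _) _.
    by rewrite lerD2r.
  - have := @cvgMr _ _ _ _ _ (c i) _ (cvgB (wlam i) (cvg_cst lam)).
    by rewrite subrr mulr0; apply.
have splitE n : \sum_(i < n.+1) c i * w n i
    = (\sum_(i < n.+1) c i) * lam + \sum_(i < n.+1) c i * (w n i - lam).
  by rewrite mulr_suml -big_split; apply: eq_bigr => i _ /=; ring.
split=> cvgS.
  have -> : (fun n => \sum_(i < n.+1) c i) = (fun n => (\sum_(i < n.+1) c i * w n i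
      - \sum_(i < n.+1) c i * (w n i - lam)) * lam^-1).
    by apply/funext => n; rewrite splitE addrK mulfK.
  have := @cvgMl _ _ _ _ _ _ lam^-1 (cvgB cvgS diff0).
  by rewrite subr0 mulfK//; apply.
under eq_fun do rewrite splitE.
by have := cvgD (@cvgMl _ _ _ _ _ _ lam cvgS) diff0; rewrite addr0; apply.
Qed.

Lemma tannery3 (f : nat -> nat -> nat -> nat -> K) (C : K) : 0 <= C ->
  (forall n i j k, `|f n i j k| <= C * r ^+ k * r ^+ j * r ^+ i) ->
  (forall i j k, (fun n => f n i j k) @ \oo --> (0 : K)) ->
  (fun n => cube_sum (f n) n) @ \oo --> (0 : K).
Proof.
move=> C0 fC f0; rewrite /cube_sum.
have r1 : 0 <= (1 - r)^-1 by rewrite invr_ge0 subr_ge0 ltW.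
have sum_le (g : nat -> K) n D : 0 <= D ->
    (forall i, `|g i| <= D * r ^+ i) -> `|\sum_(i < n) g i| <= D / (1 - r).
  move=> D0 gD; apply: le_trans (ler_norm_sum _ _ _) _.
  apply: (@le_trans _ _ (\sum_(i < n) D * r ^+ i)); first exact: ler_sum.
  by rewrite -mulr_sumr ler_wpM2l// sum_geo_le.
have rX i : 0 <= r ^+ i by exact: exprn_ge0.
apply: (@tannery (fun n i => \sum_(j < n) \sum_(k < n) f n i j k) id
  (C / (1 - r) / (1 - r))) => [|n i|i].
- by rewrite !mulr_ge0.
- rewrite mulrAC; apply: (sum_le (fun j => \sum_(k < n) f n i j k)) => [|j].
    by rewrite !mulr_ge0.
  have -> : C / (1 - r) * r ^+ i * r ^+ j = (C * r ^+ j * r ^+ i) / (1 - r) by ring.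
  apply: (sum_le (fun k => f n i j k)) => [|k]; first by rewrite !mulr_ge0.
  by apply: le_trans (fC _ _ _ _) _; rewrite le_eqVlt; apply/orP; left; apply/eqP; ring.
- apply: (@tannery (fun n j => \sum_(k < n) f n i j k) id (C * r ^+ i / (1 - r))) => [|n j|j].
  + by rewrite !mulr_ge0.
  + have -> : C * r ^+ i / (1 - r) * r ^+ j = (C * r ^+ j * r ^+ i) / (1 - r) by ring.
    apply: (sum_le (fun k => f n i j k)) => [|k]; first by rewrite !mulr_ge0.
    by apply: le_trans (fC _ _ _ _) _; rewrite le_eqVlt; apply/orP; left; apply/eqP; ring.
  + apply: (@tannery (fun n k => f n i j k) id (C * r ^+ i * r ^+ j)) => [|n k|k].
    * by rewrite !mulr_ge0.
    * by apply: le_trans (fC _ _ _ _) _; rewrite le_eqVlt; apply/orP; left; apply/eqP; ring.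
    * exact: f0.
Qed.

(** Each fixed triple eventually lies in the region, so the complement carries a dominated family
    that tends to 0 termwise. *)
Lemma cvg_cube_region (t : nat -> nat -> nat -> K)
    (P : nat -> nat -> nat -> nat -> bool) (C l : K) : 0 <= C ->
  (forall i j k, `|t i j k| <= C * r ^+ (i + j + k)) ->
  (forall i j k, \forall n \near \oo, P n i j k) ->
  (fun n => cube_sum (fun i j k => (P n i j k)%:R * t i j k) n) @ \oo --> l ->
  cube_sum t @ \oo --> l.
Proof.
move=> C0 tC Pn tl.
have -> : cube_sum t = (fun n => cube_sum (fun i j k => (P n i j k)%:R * t i j k) n +
    cube_sum (fun i j k => (~~ P n i j k)%:R * t i j k) n).
  apply/funext => n; rewrite /cube_sum -big_split; apply: eq_bigr => i _.
  rewrite -big_split; apply: eq_bigr => j _; rewrite -big_split.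
  by apply: eq_bigr => k _ /=; rewrite -mulrDl; case: (P _ _ _ _); rewrite ?addr0 ?add0r mul1r.
rewrite -[l]addr0; apply: cvgD => //.
apply: (@tannery3 (fun n i j k => (~~ P n i j k)%:R * t i j k) C) => // [n i j k|i j k].
  apply: (@le_trans _ _ `|t i j k|).
    by case: (P _ _ _ _); rewrite ?mul0r ?mul1r// normr0.
  by apply: le_trans (tC _ _ _) _; rewrite addnC (addnC i) !exprD !mulrA.
apply: cvg_near_cst; apply: filterS (Pn i j k) => n -> /=; by rewrite mul0r.
Qed.

End Tannery.

Lemma qpoch_neq0 (K : numFieldType) (q a : K) n : `|q| < 1 -> `|a| < 1 -> qpoch a q n != 0.
Proof.
move=> q_lt1 a_lt1; rewrite /qpoch; apply/prodf_neq0 => k _; rewrite subr_eq0.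
apply/eqP => aq1; suff : `|a * q ^+ k| < 1 by rewrite -aq1 normr1 ltxx.
rewrite normrM normrX; apply: le_lt_trans a_lt1.
by rewrite ler_piMr// exprn_ile1// ltW.
Qed.

(** * Convergence and nonvanishing of infinite products over the complex numbers *)

Section ComplexLimits.
Variable R : realType.
Local Notation C := (complex R : numFieldType).

Lemma normc_real (x : R) : `|x%:C%C| = (`|x|)%:C%C :> C.
Proof. by rewrite normc_def /= expr0n addr0 sqrtr_sqr. Qed.

Lemma cvg_real_complex (f : nat -> R) (l : R) :
  f @ \oo --> l -> (fun n => (f n)%:C%C : C) @ \oo --> (l%:C%C : C).
Proof.
move=> /cvgrPdist_lt fl; apply/cvgrPdist_lt => eps.
rewrite ltcE => /andP[/eqP eps_real eps0].
have -> : eps = (complex.Re eps)%:C%C by rewrite {1}(complexE eps) eps_real mulr0 addr0.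
apply: filterS (fl _ eps0) => n; rewrite -raddfB normc_real ltcR; exact.
Qed.

Lemma cvgn_geometric_increments (a : nat -> R) (D rho : R) :
  0 <= D -> 0 <= rho < 1 -> (forall n, `|a n.+1 - a n| <= D * rho ^+ n) -> cvgn a.
Proof.
move=> D0 /andP[rho0 rho1] aD.
have -> : a = (fun n => a 0 + series (telescope a) n).
  by apply/funext => n; rewrite -eq_sum_telescope.
apply: is_cvgD; first exact: is_cvg_cst.
apply: normed_cvg; apply: (@series_le_cvg _ _ (geometric D rho)) => [n|n|n|].
- by rewrite normr_ge0.
- by rewrite /= mulr_ge0// exprn_ge0.
- exact: aD.
- by apply: is_cvg_geometric_series; rewrite ger0_norm.
Qed.

Lemma complex_cvg_geometric_increments (u : nat -> C) (D rho : R) :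
  0 <= D -> 0 <= rho < 1 ->
  (forall n, `|u n.+1 - u n| <= (D * rho ^+ n)%:C%C) -> exists l : C, u @ \oo --> l.
Proof.
move=> D0 rho01 uD.
have Re_cvg : cvgn (fun n => complex.Re (u n)).
  apply: (cvgn_geometric_increments D0 rho01) => n.
  rewrite -raddfB -lecR; apply: le_trans (uD n); exact: normc_ge_Re.
have Im_cvg : cvgn (fun n => complex.Im (u n)).
  apply: (cvgn_geometric_increments D0 rho01) => n.
  rewrite -raddfB -lecR; apply: le_trans (uD n).
  (* The imaginary part of x is minus the real part of ix, so the bound for real parts applies
     again. *)
  have := normc_ge_Re ((u n.+1 - u n) * 'i%C); rewrite ReiNIm normrN normrM.
  by rewrite [`|'i%C|]normc_def /= expr0n expr1n add0r sqrtr1 mulr1.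
have lim_parts := cvgD (cvg_real_complex Re_cvg)
  (@cvgMr C _ _ _ _ 'i%C _ (cvg_real_complex Im_cvg)).
pose v n : C := (complex.Re (u n))%:C%C + 'i%C * (complex.Im (u n))%:C%C.
have [l vl] : exists l : C, v @ \oo --> l by eexists; exact: lim_parts.
have uv : u = v by apply/funext => n; exact/complexE.
by exists l; rewrite uv.
Qed.

Lemma prod_1Dgeo_le (c rho : R) n : 0 <= c -> 0 <= rho < 1 ->
  \prod_(k < n) (1 + c * rho ^+ k) <= expR (c / (1 - rho)).
Proof.
move=> c0 /andP[rho0 rho1].
apply: (@le_trans _ _ (expR (\sum_(k < n) c * rho ^+ k))).
  rewrite expR_sum; apply: ler_prod => k _.
  by rewrite expR_ge1Dx addr_ge0// mulr_ge0// exprn_ge0.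
by rewrite ler_expR -mulr_sumr ler_wpM2l// sum_geo_le.
Qed.

Lemma normc_lt1 (x : C) : `|x| < 1 -> exists2 rho : R, 0 <= rho < 1 & `|x| = rho%:C%C.
Proof.
rewrite normc_def; set rho := Num.sqrt _ => xlt1; exists rho => //.
by rewrite sqrtr_ge0 -ltcR.
Qed.

Variable q : C.
Hypothesis q_lt1 : `|q| < 1.

Lemma cvg_normX : (fun n => `|q| ^+ n) @ \oo --> (0 : C).
Proof.
have [rho /andP[rho0 rho1] ->] := normc_lt1 q_lt1.
under eq_fun do rewrite -rmorphXn.
have -> : 0 = 0%:C%C :> C by [].
by apply: cvg_real_complex; apply: cvg_expr; rewrite ger0_norm.
Qed.

(** The bound on the inverses keeps the infinite product away from 0 and later dominates the
    summands. *)
Lemma qpoch_le a : `|a| < 1 -> exists2 B : R, 0 <= B &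
  forall n, `|qpoch a q n| <= B%:C%C /\ `|(qpoch a q n)^-1| <= B%:C%C.
Proof.
move=> a_lt1; have [rho rho01 qE] := normc_lt1 q_lt1.
have [al /andP[al0 al1] aE] := normc_lt1 a_lt1.
have [rho0 rho1] := andP rho01.
have al1' : 0 < 1 - al by rewrite subr_gt0.
(* This c satisfies al <= c and 1/(1 - al x) <= 1 + c x for 0 <= x <= 1, so a single product bounds
   both (a;q)_n and its inverse. *)
pose c := al / (1 - al); have c0 : 0 <= c by rewrite divr_ge0// ltW.
have alc : al <= c by rewrite ler_pdivlMr// ler_piMr// gerBl.
have bound (x : nat -> C) n : (forall k, `|x k| <= (1 + c * rho ^+ k)%:C%C) ->
    `|\prod_(k < n) x k| <= (expR (c / (1 - rho)))%:C%C.
  move=> xc; rewrite normr_prod.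
  apply: (@le_trans _ _ (\prod_(k < n) (1 + c * rho ^+ k)%:C%C)).
    by apply: ler_prod => k _; rewrite normr_ge0 xc.
  by rewrite -rmorph_prod lecR prod_1Dgeo_le.
have aqE k : `|a * q ^+ k| = (al * rho ^+ k)%:C%C.
  by rewrite normrM normrX aE qE -rmorphXn -rmorphM.
have rX k : 0 <= rho ^+ k <= 1 by rewrite exprn_ge0//= exprn_ile1// ltW.
exists (expR (c / (1 - rho))) => [|n]; first exact: expR_ge0.
split; first apply: (bound (fun k => 1 - a * q ^+ k)) => k.
  apply: le_trans (ler_normB _ _) _; rewrite normr1 aqE.
  rewrite -[1](rmorph1 (real_complex R)) -rmorphD lecR lerD2l.
  by have /andP[? _] := rX k; rewrite ler_wpM2r.
rewrite /qpoch -prodfV; apply: (bound (fun k => (1 - a * q ^+ k)^-1)) => k.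
have /andP[r0 r1] := rX k.
have x1 : al * rho ^+ k < 1 by apply: le_lt_trans al1; rewrite ler_piMr.
have low : (1 - al * rho ^+ k)%:C%C <= `|1 - a * q ^+ k|.
  have -> : (1 - al * rho ^+ k)%:C%C = `|1 : C| - `|a * q ^+ k|.
    by rewrite normr1 aqE rmorphB rmorph1.
  exact: lerB_dist.
have x1' : 0 < 1 - al * rho ^+ k by rewrite subr_gt0.
have low0 : 0 < (1 - al * rho ^+ k)%:C%C :> C by rewrite ltcR.
rewrite normfV; apply: (@le_trans _ _ ((1 - al * rho ^+ k)%:C%C^-1)).
  by rewrite lef_pV2// posrE// (lt_le_trans low0).
rewrite -fmorphV lecR -[X in X <= _]mul1r ler_pdivrMr//.
have -> : (1 + c * rho ^+ k) * (1 - al * rho ^+ k)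
    = 1 + rho ^+ k * (c * (1 - al) + c * al * (1 - rho ^+ k) - al) by ring.
rewrite /c divfK ?gt_eqF// addrAC subrr add0r lerDl.
by rewrite !mulr_ge0// ?subr_ge0// ?invr_ge0 ltW.
Qed.

Lemma cvg_qpoch a : `|a| < 1 ->
  qpoch a q @ \oo --> qpoch_inf a q /\ qpoch_inf a q != 0.
Proof.
move=> a_lt1; have [B B0 qB] := qpoch_le a_lt1.
have [rho rho01 qE] := normc_lt1 q_lt1.
have [l ul] : exists l : C, qpoch a q @ \oo --> l.
  apply: (complex_cvg_geometric_increments B0 rho01) => n.
  have -> : qpoch a q n.+1 - qpoch a q n = - (qpoch a q n * (a * q ^+ n)).
    by rewrite qpochS; ring.
  rewrite normrN normrM rmorphM ler_pM// ?(qB n).1//.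
  rewrite normrM normrX rmorphXn /= -qE.
  by rewrite ler_piMl ?exprn_ge0// ltW.
have -> : qpoch_inf a q = l by apply: cvg_lim => //; exact: norm_hausdorff.
(* A zero limit would bring some |(a;q)_n| below 1/(B + 1), against the bound B on the inverses. *)
split=> //; apply/eqP => l0; rewrite l0 in ul.
have B1 : 0 < (B + 1)%:C%C :> C by rewrite ltcR ltr_wpDl.
have iB1 : 0 < (B + 1)%:C%C^-1 :> C by rewrite invr_gt0.
have /cvgr0Pnorm_lt/(_ _ iB1) [n _ /(_ n (leqnn n))/= small] := ul.
have : (B + 1)%:C%C < `|(qpoch a q n)^-1|.
  rewrite normfV -[X in X < _]invrK ltf_pV2// posrE// normr_gt0.
  exact: qpoch_neq0.
move=> /lt_le_trans/(_ (qB n).2); rewrite ltcR.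
by rewrite gtrDl ltr10.
Qed.

End ComplexLimits.

Lemma leq_sqr n : (n <= n ^ 2)%N.
Proof. by case: n => // n; rewrite -mulnn leq_pmulr. Qed.

(** * The Rogers-Ramanujan identities and the two families of triple sums *)

Section RogersRamanujan.
Variables (K : numFieldType) (q : K).
Hypothesis q_lt1 : `|q| < 1.
Hypothesis normq_cvg : (fun n => `|q| ^+ n) @ \oo --> (0 : K).
Hypothesis qpoch_cvg : forall p a : K, `|p| < 1 -> `|a| < 1 ->
  [/\ qpoch a p @ \oo --> qpoch_inf a p, qpoch_inf a p != 0 &
      exists2 B : K, 0 <= B & forall n, `|(qpoch a p n)^-1| <= B].

Let qX_lt1 m : `|q ^+ m.+1| < 1.
Proof. by rewrite normrX exprn_ilt1. Qed.

Let qX_le m n : (n <= m)%N -> `|q ^+ m| <= `|q| ^+ n.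
Proof. by move=> lenm; rewrite normrX ler_wiXn2l// ltW. Qed.

Let qpoch_nz (p a : K) n : `|p| < 1 -> `|a| < 1 -> qpoch a p n != 0.
Proof. exact: qpoch_neq0. Qed.

Let cvg_sub (u : nat -> K) (l : K) j : u @ \oo --> l -> (fun n => u (n - j)%N) @ \oo --> l.
Proof. by move=> ul; rewrite -(cvg_shiftn j); under eq_fun do rewrite addnK. Qed.

Let cvg_add (u : nat -> K) (l : K) j : u @ \oo --> l -> (fun n => u (n + j)%N) @ \oo --> l.
Proof. by rewrite (cvg_shiftn j). Qed.

Let cvg_mul (u : nat -> K) (l : K) (f : nat -> nat) : (forall n, (n <= f n)%N) ->
  u @ \oo --> l -> (fun n => u (f n)) @ \oo --> l.
Proof.
move=> lef ul; apply: (cvg_comp f u _ ul) => A [N _ NA]; exists N => // n /= leNn.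
by apply: NA => /=; exact: leq_trans (lef n).
Qed.

Let theta_le (e : bool) j :
  `|jtp_fold q e q 1 j * q ^+ (2 * (j ^ 2 + e * j))| <= 2 * `|q| ^+ j.
Proof.
rewrite normrM; apply: ler_pM => //; last first.
  by apply: qX_le; rewrite mul2n -addnn -addnA (leq_trans (leq_sqr j))// leq_addr.
have le1 m n : `|(- q) ^+ m * q ^+ n| <= 1.
  by rewrite normrM normrX normrN normrX mulr_ile1// exprn_ile1// ltW.
have le1' m n : `|(- 1) ^+ m * q ^+ n| <= 1.
  by rewrite normrM normrX normrN1 expr1n mul1r normrX exprn_ile1// ltW.
rewrite /jtp_fold; case: e => /=; last case: j => [|j].
- by apply: le_trans (ler_normD _ _) _; rewrite lerD.
- by rewrite normr1 ler1n.
- by rewrite mulrDl; apply: le_trans (ler_normD _ _) _; rewrite lerD.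
Qed.

Lemma cvg_rogers_ramanujan_theta (e : bool) :
  (fun N => \sum_(n < N) q ^+ (n ^ 2 + e * n) / qpoch q q n) @ \oo -->
  qpoch_inf (if e then q else q ^+ 3) (q ^+ 5) *
  qpoch_inf (if e then q ^+ 4 else q ^+ 2) (q ^+ 5) *
  qpoch_inf (q ^+ 5) (q ^+ 5) / qpoch_inf q q.
Proof.
set a := if e then q else _; set b := if e then q ^+ 4 else _.
have q5_lt1 := qX_lt1 4.
have ab : a * b = q ^+ 5 by rewrite /a /b; case: (e); rewrite -?exprS// -exprD.
have a_lt1 : `|a| < 1 by rewrite /a; case: (e); rewrite ?qX_lt1.
have b_lt1 : `|b| < 1 by rewrite /b; case: (e); rewrite ?qX_lt1.
have [a_cvg _ _] := qpoch_cvg q5_lt1 a_lt1.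
have [b_cvg _ _] := qpoch_cvg q5_lt1 b_lt1.
have [P5_cvg P5_neq0 [B5 B5_ge0 P5B]] := qpoch_cvg q5_lt1 q5_lt1.
have [P_cvg P_neq0 [B B_ge0 PB]] := qpoch_cvg q_lt1 q_lt1.
pose iq n := (qpoch q q n)^-1; pose i5 n := (qpoch (q ^+ 5) (q ^+ 5) n)^-1.
have i_cvg : iq @ \oo --> (qpoch_inf q q)^-1 by apply: cvgV.
have i5_cvg : i5 @ \oo --> (qpoch_inf (q ^+ 5) (q ^+ 5))^-1 by apply: cvgV.
have pair_cvg (u : nat -> K) (l : K) j : u @ \oo --> l ->
    (fun n => u (n - j)%N * u (n + j + e)%N) @ \oo --> l * l.
  move=> ul; apply: cvgM; first exact: cvg_sub.
  by under eq_fun do rewrite -addnA; exact: cvg_add.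
have pair_le (u : nat -> K) D n j : (forall m, `|u m| <= D) ->
    `|u (n - j)%N * u (n + j + e)%N| <= D * D.
  by move=> uD; rewrite normrM ler_pM.
pose c j := jtp_fold q e q 1 j * q ^+ (2 * (j ^ 2 + e * j)).
pose S := qpoch_inf a (q ^+ 5) * qpoch_inf b (q ^+ 5) * qpoch_inf (q ^+ 5) (q ^+ 5).
(* The theta series is summed by weighting it: with the factors [i5] the partial sum is the finite
   triple product in base q^5, whose limit is known. *)
have c_cvg : (fun n => \sum_(j < n.+1) c j) @ \oo --> S.
  apply/(@tannery_weight _ `|q| (normr_ge0 _) q_lt1 normq_cvg c
    (fun n j => i5 (n - j)%N * i5 (n + j + e)%N) 2 (B5 * B5)
    ((qpoch_inf (q ^+ 5) (q ^+ 5))^-1 * (qpoch_inf (q ^+ 5) (q ^+ 5))^-1)).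
  - by [].
  - exact: mulr_ge0.
  - by rewrite mulf_neq0// invr_neq0.
  - exact: theta_le.
  - by move=> n j; exact: (pair_le i5).
  - by move=> j; exact: (pair_cvg i5).
  rewrite /S mulrA mulfK//.
  have -> : (fun n => \sum_(i < n.+1) c i * (i5 (n - i)%N * i5 (n + i + e)%N)) =
      (fun n => qpoch a (q ^+ 5) (n + e) * qpoch b (q ^+ 5) n * i5 (n + e + n)%N).
    apply/funext => n; rewrite -folded_jtp//; last by move=> m; exact: qpoch_nz.
    by apply: eq_bigr => j _; rewrite /c theta_base_change.
  apply: cvgM; first by apply: cvgM => //; exact: cvg_add.
  by apply: (@cvg_mul i5) => // n; rewrite -addnA leq_addr.
(* In base q the weights of the finite identity tend to 1/(q)_oo on the left and to 1/(q)_oo^2 on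
   the right, which leaves S / (q)_oo. *)
have rr_cvg : (fun n => \sum_(s < n.+1) q ^+ (s ^ 2 + e * s) / qpoch q q s) @ \oo -->
    S / qpoch_inf q q.
  apply/(@tannery_weight _ `|q| (normr_ge0 _) q_lt1 normq_cvg
    (fun s => q ^+ (s ^ 2 + e * s) / qpoch q q s) (fun n s => iq (n - s)%N)
    B B (qpoch_inf q q)^-1) => //.
  - by rewrite invr_neq0.
  - move=> s; rewrite normrM mulrC ler_pM//.
    by apply: qX_le; rewrite (leq_trans (leq_sqr s))// leq_addr.
  - by move=> n s; exact: PB.
  - by move=> s; exact: cvg_sub.
  have -> : (fun n => \sum_(s < n.+1) q ^+ (s ^ 2 + e * s) / qpoch q q s * iq (n - s)%N)
      = (fun n => \sum_(j < n.+1) c j * (iq (n - j)%N * iq (n + j + e)%N)).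
    apply/funext => n; rewrite -finite_rogers_ramanujan.
      by apply: eq_bigr => s _; rewrite mulrA.
    by move=> m; exact: qpoch_nz.
  rewrite -mulrA; apply/(@tannery_weight _ `|q| (normr_ge0 _) q_lt1 normq_cvg c
    (fun n j => iq (n - j)%N * iq (n + j + e)%N) 2 (B * B)).
  - by [].
  - exact: mulr_ge0.
  - by rewrite mulf_neq0// invr_neq0.
  - exact: theta_le.
  - by move=> n j; exact: (pair_le iq).
  - by move=> j; exact: (pair_cvg iq).
  exact: c_cvg.
by rewrite -cvg_shiftS.
Qed.

(** The factors of (q;q)_(5n) are sorted by the residue of their exponent mod 5, and n tends to
    infinity along this subsequence. *)
Lemma qpoch_inf_dissect : qpoch_inf q q =
  qpoch_inf q (q ^+ 5) * qpoch_inf (q ^+ 2) (q ^+ 5) * qpoch_inf (q ^+ 3) (q ^+ 5)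
  * qpoch_inf (q ^+ 4) (q ^+ 5) * qpoch_inf (q ^+ 5) (q ^+ 5).
Proof.
have q5_lt1 := qX_lt1 4.
have [P_cvg _ _] := qpoch_cvg q_lt1 q_lt1.
have A_cvg m : qpoch (q ^+ m.+1) (q ^+ 5) @ \oo --> qpoch_inf (q ^+ m.+1) (q ^+ 5).
  by have [] := qpoch_cvg q5_lt1 (qX_lt1 m).
have /(cvg_unique (@norm_hausdorff _ _)) := @cvg_mul (qpoch q q) _ (fun n => 5 * n)%N
  (fun n => @leq_pmull n 5 isT) P_cvg; apply.
have -> : (fun n => qpoch q q (5 * n)) = (fun n => qpoch q (q ^+ 5) n *
    qpoch (q ^+ 2) (q ^+ 5) n * qpoch (q ^+ 3) (q ^+ 5) n
    * qpoch (q ^+ 4) (q ^+ 5) n * qpoch (q ^+ 5) (q ^+ 5) n).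
  apply/funext; elim => [|n IHn]; first by rewrite !qpoch0 !mulr1.
  have -> : (5 * n.+1 = (5 * n).+1.+4)%N by lia.
  rewrite !qpochS IHn -!exprM -!exprS -!exprD.
  have -> : (2 + 5 * n = (5 * n).+2)%N by lia.
  have -> : (3 + 5 * n = (5 * n).+3)%N by lia.
  have -> : (4 + 5 * n = (5 * n).+4)%N by lia.
  have -> : (5 + 5 * n = (5 * n).+1.+4)%N by lia.
  ring.
do 4?[apply: cvgM; last exact: A_cvg]; exact: (A_cvg 0%N).
Qed.

Definition rr_value (e : bool) : K :=
  if e then (qpoch_inf (q ^+ 2) (q ^+ 5) * qpoch_inf (q ^+ 3) (q ^+ 5))^-1
  else (qpoch_inf q (q ^+ 5) * qpoch_inf (q ^+ 4) (q ^+ 5))^-1.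

Let A_neq0 m : qpoch_inf (q ^+ m.+1) (q ^+ 5) != 0.
Proof. by have [] := qpoch_cvg (qX_lt1 4) (qX_lt1 m). Qed.

Lemma cvg_rogers_ramanujan (e : bool) :
  (fun N => \sum_(n < N) q ^+ (n ^ 2 + e * n) / qpoch q q n) @ \oo --> rr_value e.
Proof.
have -> : rr_value e = qpoch_inf (if e then q else q ^+ 3) (q ^+ 5) *
    qpoch_inf (if e then q ^+ 4 else q ^+ 2) (q ^+ 5) *
    qpoch_inf (q ^+ 5) (q ^+ 5) / qpoch_inf q q; last first.
  exact: cvg_rogers_ramanujan_theta.
rewrite qpoch_inf_dissect /rr_value.
have := A_neq0 0; rewrite expr1 => n1.
by case: e; field; rewrite ?n1 ?A_neq0.
Qed.

Lemma rr_value_product : rr_value true * rr_value false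
  = qpoch_inf (q ^+ 5) (q ^+ 5) / qpoch_inf q q.
Proof.
rewrite qpoch_inf_dissect /rr_value; have := A_neq0 0; rewrite expr1 => n1.
by field; rewrite ?n1 ?A_neq0.
Qed.

(** Serves p = q and p = q^2: an exponent of at least i + j + k gives the geometric domination that
    [cvg_cube_region] asks for. *)
Let summand_le (p : K) (E : nat -> nat -> nat -> nat) : `|p| < 1 ->
  (forall i j k, i + j + k <= E i j k)%N ->
  exists2 B, 0 <= B & forall i j k,
    `|q ^+ E i j k / (qpoch p p i * qpoch p p j * qpoch p p k)|
      <= B * `|q| ^+ (i + j + k).
Proof.
move=> p_lt1 leE; have [_ _ [B B0 pB]] := qpoch_cvg p_lt1 p_lt1.
exists (B * B * B) => [|i j k]; first by rewrite !mulr_ge0.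
rewrite mulrC normrM !invfM !normrM ler_pM ?mulr_ge0 ?qX_le//.
by rewrite !ler_pM ?mulr_ge0.
Qed.

Lemma cvg_nahm_square (e e' : bool) :
  cube_sum (fun i j k =>
    q ^+ ((i + j) ^ 2 + e * (i + j) + ((i + k) ^ 2 + e' * (i + k)) + j * k)%N /
    (qpoch q q i * qpoch q q j * qpoch q q k)) @ \oo --> rr_value e * rr_value e'.
Proof.
have [|B B0 tB] := @summand_le q (fun i j k =>
  (i + j) ^ 2 + e * (i + j) + ((i + k) ^ 2 + e' * (i + k)) + j * k)%N q_lt1.
  by move=> i j k; nia.
(* Restricted to this region, the cube sum is exactly a product of two truncated Rogers-Ramanujan
   series. *)
apply: (@cvg_cube_region _ `|q| (normr_ge0 _) q_lt1 normq_cvg _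
  (fun n i j k => (i + j < n) && (i + k < n))%N _ _ B0 tB).
  move=> i j k; near=> n; apply/andP.
  by split; near: n; exact: nbhs_infty_gt.
have -> : (fun n => cube_sum (fun i j k => ((i + j < n) && (i + k < n))%N%:R *
   (q ^+ ((i + j) ^ 2 + e * (i + j) + ((i + k) ^ 2 + e' * (i + k)) + j * k)%N /
    (qpoch q q i * qpoch q q j * qpoch q q k))) n) =
  (fun N => (\sum_(n < N) q ^+ (n ^ 2 + e * n) / qpoch q q n) *
  (\sum_(n < N) q ^+ (n ^ 2 + e' * n) / qpoch q q n)); last first.
  by apply: cvgM; exact: cvg_rogers_ramanujan.
apply/funext => N; rewrite (qvandermonde_region _ (fun n => q ^+ (n ^ 2 + e * n))
  (fun n => q ^+ (n ^ 2 + e' * n))); last by move=> m; exact: qpoch_nz.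
by rewrite /cube_sum; do 3![apply: eq_bigr => ? _]; rewrite !exprD.
Unshelve. all: by end_near.
Qed.

Lemma cvg_nahm_single (e : bool) :
  cube_sum (fun i j k =>
    q ^+ ((2 * i + j + k) ^ 2 + e * (2 * i + j + k) + (j ^ 2 - j + k ^ 2))%N /
    (qpoch (q ^+ 2) (q ^+ 2) i * qpoch (q ^+ 2) (q ^+ 2) j * qpoch (q ^+ 2) (q ^+ 2) k))
  @ \oo --> rr_value e.
Proof.
have q2_lt1 := qX_lt1 1.
have [|B B0 tB] := @summand_le (q ^+ 2) (fun i j k =>
  (2 * i + j + k) ^ 2 + e * (2 * i + j + k) + (j ^ 2 - j + k ^ 2))%N q2_lt1.
  by move=> i j k; nia.
apply: (@cvg_cube_region _ `|q| (normr_ge0 _) q_lt1 normq_cvg _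
  (fun n i j k => 2 * i + j + k < n)%N _ _ B0 tB).
  by move=> i j k; exact: nbhs_infty_gt.
have -> : (fun n => cube_sum (fun i j k => (2 * i + j + k < n)%N%:R *
   (q ^+ ((2 * i + j + k) ^ 2 + e * (2 * i + j + k) + (j ^ 2 - j + k ^ 2))%N /
    (qpoch (q ^+ 2) (q ^+ 2) i * qpoch (q ^+ 2) (q ^+ 2) j
     * qpoch (q ^+ 2) (q ^+ 2) k))) n) =
  (fun N => \sum_(n < N) q ^+ (n ^ 2 + e * n) / qpoch q q n); last first.
  exact: cvg_rogers_ramanujan.
apply/funext => N; rewrite (euler_region _ _ (fun n => q ^+ (n ^ 2 + e * n))).
- by rewrite /cube_sum; do 3![apply: eq_bigr => ? _]; rewrite [in LHS]exprD.
- by move=> m; exact: qpoch_nz.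
- by move=> m; exact: qpoch_nz.
Qed.

End RogersRamanujan.

(** * Matching the exponents with the five sums *)

Lemma cvg_cube_ext (K : numFieldType) (F G : nat -> nat -> nat -> K) (l : K) :
  (forall i j k, F i j k = G i j k) -> cube_sum G @ \oo --> l -> cube_sum F @ \oo --> l.
Proof.
move=> FG; have -> // : cube_sum F = cube_sum G.
by apply/funext => N; rewrite /cube_sum; do 3![apply: eq_bigr => ? _].
Qed.

Lemma cube_sumC (K : numFieldType) (F : nat -> nat -> nat -> K) :
  cube_sum F = cube_sum (fun i j k => F i k j).
Proof.
by apply/funext => N; apply: eq_bigr => i _; rewrite exchange_big.
Qed.

Unset Implicit Arguments.

Theorem theorem4p11 (R : realType) (q : complex R) (hq : `|q| < 1) :
  [/\ cube_sum (fun i j k =>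
         q ^+ (4 * i^2 + 2 * j^2 + 2 * k^2 + 4 * i * j + 4 * i * k + 2 * j * k - j)%N /
         (qpoch (q^+2) (q^+2) i * qpoch (q^+2) (q^+2) j * qpoch (q^+2) (q^+2) k))
       @ \oo --> (qpoch_inf q (q^+5) * qpoch_inf (q^+4) (q^+5))^-1,
      cube_sum (fun i j k =>
         q ^+ (2 * i^2 + j^2 + k^2 + 2 * i * j + 2 * i * k + j * k)%N /
         (qpoch q q i * qpoch q q j * qpoch q q k))
       @ \oo --> ((qpoch_inf q (q^+5) * qpoch_inf (q^+4) (q^+5)) ^+ 2)^-1,
      cube_sum (fun i j k =>
         q ^+ (4 * i^2 + 2 * j^2 + 2 * k^2 + 4 * i * j + 4 * i * k + 2 * j * k + 2 * i + j)%N /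
         (qpoch (q^+2) (q^+2) i * qpoch (q^+2) (q^+2) j * qpoch (q^+2) (q^+2) k))
       @ \oo --> (qpoch_inf (q^+2) (q^+5) * qpoch_inf (q^+3) (q^+5))^-1,
      cube_sum (fun i j k =>
         q ^+ (2 * i^2 + j^2 + k^2 + 2 * i * j + 2 * i * k + j * k + i + j)%N /
         (qpoch q q i * qpoch q q j * qpoch q q k))
       @ \oo --> qpoch_inf (q^+5) (q^+5) / qpoch_inf q q &
      cube_sum (fun i j k =>
         q ^+ (2 * i^2 + j^2 + k^2 + 2 * i * j + 2 * i * k + j * k + 2 * i + j + k)%N /
         (qpoch q q i * qpoch q q j * qpoch q q k))
       @ \oo --> ((qpoch_inf (q^+2) (q^+5) * qpoch_inf (q^+3) (q^+5)) ^+ 2)^-1].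
Proof.
have qX_cvg := cvg_normX hq.
have qpoch_cvg (p a : complex R : numFieldType) : `|p| < 1 -> `|a| < 1 ->
    [/\ qpoch a p @ \oo --> qpoch_inf a p, qpoch_inf a p != 0 &
      exists2 B : (complex R : numFieldType),
        0 <= B & forall n, `|(qpoch a p n)^-1| <= B].
  move=> p_lt1 a_lt1; have [? ?] := cvg_qpoch p_lt1 a_lt1; split=> //.
  have [B B0 pB] := qpoch_le p_lt1 a_lt1.
  by exists B%:C%C => [|n]; [rewrite ler0c | have [] := pB n].
have single := cvg_nahm_single hq qX_cvg qpoch_cvg.
have square := cvg_nahm_square hq qX_cvg qpoch_cvg.
split.
- apply: cvg_cube_ext (single false) => i j k; congr (q ^+ _ / _).
  (* Subtraction is truncated; j <= j^2 makes the two placements of - j agree. *)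
  by have := leq_sqr j; lia.
- rewrite expr2 invfM; apply: cvg_cube_ext (square false false) => i j k.
  by congr (q ^+ _ / _); lia.
(* For e = 1 the linear part is 2i + j + k - j = 2i + k, so j and k are exchanged first. *)
- rewrite cube_sumC; apply: cvg_cube_ext (single true) => i j k.
  rewrite [_ * qpoch _ _ k * _]mulrAC; congr (q ^+ _ / _).
  by have := leq_sqr j; lia.
- rewrite -(rr_value_product hq qpoch_cvg).
  apply: cvg_cube_ext (square true false) => i j k.
  by congr (q ^+ _ / _); lia.
- rewrite expr2 invfM; apply: cvg_cube_ext (square true true) => i j k.
  by congr (q ^+ _ / _); lia.
Qed.
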